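(* Let $(P,\leq)$ be a finite poset, let $\mathbf{k}$ be a field, and let $A$ be the incidence algebra of $(P,\leq)$ over $\mathbf{k}$. Then the poset of $\omega$-torsion pairs of $A$ is isomorphic to the distributive lattice of order ideals of the opposite poset $(P,\leq)^{op}$, ordered by inclusion.
   Context: The incidence algebra of a finite poset $(P,\leq)$ over $\mathbf{k}$ is the finite dimensional $\mathbf{k}$-algebra with basis $\{e_{x,y} : x\leq y \text{ in } P\}$ and multiplication $e_{x,y}e_{y',z}=e_{x,z}$ if $y=y'$ and $0$ otherwise. $\operatorname{mod} A$ denotes the category of finitely generated right $A$-modules. Subcategories are full and closed under isomorphisms. A torsion pair of $\operatorname{mod} A$ is a pair $(\mathcal{T},\mathcal{F})$ of subcategories such that (1) $\operatorname{Hom}_A(T,F)=0$ for all $T\in\mathcal{T}$, $F\in\mathcal{F}$; (2) for every $X\in\operatorname{mod} A$ there is a short exact sequence $0\to t(X)\to X\to f(X)\to 0$ with $t(X)\in\mathcal{T}$ and $f(X)\in\mathcal{F}$. An $\omega$-torsion pair (also called $\omega_1$-torsion pair) of $A$ is a torsion pair $(\mathcal{T},\mathcal{F})$ of $\operatorname{mod} A$ such that $\operatorname{Ext}^1_A(T,F)=0$ for all $T\in\mathcal{T}$, $F\in\mathcal{F}$. The $\omega$-torsion pairs are ordered by $(\mathcal{T}_1,\mathcal{F}_1)\leq(\mathcal{T}_2,\mathcal{F}_2)$ if and only if $\mathcal{T}_1\subseteq\mathcal{T}_2$ (equivalently $\mathcal{F}_2\subseteq\mathcal{F}_1$). An order ideal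 of a poset $(Q,\preceq)$ is a subset $I\subseteq Q$ such that $x\in I$ and $y\preceq x$ imply $y\in I$. The poset $(P,\leq)^{op}$ has the same elements as $P$ and the reversed order. *)

(* Defs.v *)
From HB Require Import structures.
From mathcomp Require Import all_boot all_order all_algebra.

Set Implicit Arguments.
Unset Strict Implicit.
Unset Printing Implicit Defensive.

Import Order.TTheory Order.DefaultSetSubsetOrder GRing.Theory.

Local Open Scope ring_scope.

Section IncidenceAlgebra.
Context (k : fieldType) (d : Order.disp_t) (P : finPOrderType d).

Definition interval := {xy : P * P | (xy.1 <= xy.2)%O}.

(* The coordinates of an element in the basis (e_{x,y})_{x <= y}.  The type is
   renamed because {ffun _ -> _} carries the pointwise product. *)
Definition incidence_algebra : Type := {ffun interval -> k}.

HB.instance Definition _ := GRing.Lmodule.copy incidence_algebra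
  {ffun interval -> k^o}.

Implicit Types f g h : incidence_algebra.

(* The coordinate on e_{x,y}, extended by 0 to all pairs (x, y). *)
Definition inc_coef f (x y : P) : k :=
  if insub (x, y) is Some u then f u else 0.

Definition inc_one : incidence_algebra :=
  [ffun u : interval => ((val u).1 == (val u).2)%:R].

Definition inc_mul f g : incidence_algebra :=
  [ffun u : interval =>
     \sum_y inc_coef f (val u).1 y * inc_coef g y (val u).2].

Lemma inc_coefP f g :
  (forall x y, inc_coef f x y = inc_coef g x y) -> f = g.
Proof.
move=> fg; apply/ffunP => u; have := fg (val u).1 (val u).2.
by rewrite /inc_coef -surjective_pairing valK.
Qed.

Lemma inc_coef_out f x y : ~~ (x <= y)%O -> inc_coef f x y = 0.
Proof. by move=> xy; rewrite /inc_coef insubN. Qed.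

Lemma inc_coefD f g x y : inc_coef (f + g) x y = inc_coef f x y + inc_coef g x y.
Proof. by rewrite /inc_coef; case: insub => [u|]; rewrite ?ffunE ?addr0. Qed.

Lemma inc_coefZ (a : k) f x y : inc_coef (a *: f) x y = a * inc_coef f x y.
Proof. by rewrite /inc_coef; case: insub => [u|]; rewrite ?ffunE ?mulr0. Qed.

Lemma inc_coef1 x y : inc_coef inc_one x y = (x == y)%:R.
Proof.
rewrite /inc_coef; case: insubP => [u _ uE|/= xy]; first by rewrite ffunE uE.
by case: eqP xy => // ->; rewrite lexx.
Qed.

Lemma inc_coefM f g x z :
  inc_coef (inc_mul f g) x z = \sum_y inc_coef f x y * inc_coef g y z.
Proof.
rewrite {1}/inc_coef; case: insubP => [u _ uE|/= xz]; first by rewrite ffunE uE.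
rewrite big1 // => y _; have [xy|xy] := boolP (x <= y)%O; last first.
  by rewrite inc_coef_out // mul0r.
have [yz|yz] := boolP (y <= z)%O; first by rewrite (le_trans xy yz) in xz.
by rewrite (inc_coef_out g yz) mulr0.
Qed.

Fact inc_mulA : associative inc_mul.
Proof.
move=> f g h; apply: inc_coefP => x t; rewrite !inc_coefM.
under eq_bigr do rewrite inc_coefM mulr_sumr.
rewrite exchange_big; apply: eq_bigr => z _; rewrite inc_coefM mulr_suml.
by apply: eq_bigr => y _; rewrite mulrA.
Qed.

Fact inc_mul1l : left_id inc_one inc_mul.
Proof.
move=> f; apply: inc_coefP => x z; rewrite inc_coefM (bigD1 x) //=.
rewrite inc_coef1 eqxx mul1r big1 ?addr0 // => y yx.
by rewrite inc_coef1 eq_sym (negPf yx) mul0r.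
Qed.

Fact inc_mul1r : right_id inc_one inc_mul.
Proof.
move=> f; apply: inc_coefP => x z; rewrite inc_coefM (bigD1 z) //=.
rewrite inc_coef1 eqxx mulr1 big1 ?addr0 // => y yz.
by rewrite inc_coef1 (negPf yz) mulr0.
Qed.

Fact inc_mulDl : left_distributive inc_mul +%R.
Proof.
move=> f g h; apply: inc_coefP => x z; rewrite inc_coefD !inc_coefM -big_split.
by apply: eq_bigr => y _; rewrite inc_coefD mulrDl.
Qed.

Fact inc_mulDr : right_distributive inc_mul +%R.
Proof.
move=> f g h; apply: inc_coefP => x z; rewrite inc_coefD !inc_coefM -big_split.
by apply: eq_bigr => y _; rewrite inc_coefD mulrDr.
Qed.

(* Only a pzRingType: the algebra is zero when P is empty. *)
HB.instance Definition _ := GRing.Zmodule_isPzRing.Build incidence_algebra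
  inc_mulA inc_mul1l inc_mul1r inc_mulDl inc_mulDr.

Definition inc_basis (u : interval) : incidence_algebra :=
  [ffun v : interval => (v == u)%:R].

Lemma inc_coef_basis u x y :
  inc_coef (inc_basis u) x y = ((x, y) == val u)%:R.
Proof.
rewrite /inc_coef; case: insubP => [v _ vE|xy].
  by rewrite ffunE -vE -val_eqE.
by case: eqP xy => // ->; rewrite (valP u).
Qed.

Lemma inc_basis_sum f : f = \sum_u f u *: inc_basis u.
Proof.
apply/ffunP => v; rewrite sum_ffunE (bigD1 v) //= big1 ?addr0.
  by rewrite !ffunE eqxx [_ *: _]mulr1.
by move=> u uv; rewrite !ffunE eq_sym (negPf uv) [_ *: _]mulr0.
Qed.

Lemma inc_basisM x y y' z (xy : (x <= y)%O) (yz : (y' <= z)%O)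
    (xz : (x <= z)%O) :
  inc_basis (exist _ (x, y) xy) * inc_basis (exist _ (y', z) yz) =
  if y == y' then inc_basis (exist _ (x, z) xz) else 0.
Proof.
apply: inc_coefP => s t; rewrite inc_coefM.
under eq_bigr do rewrite !inc_coef_basis -natrM mulnb.
rewrite (bigD1 y) //= big1 ?addr0 => [|i iy]; last first.
  by rewrite !xpair_eqE (negPf iy) andbF.
rewrite !xpair_eqE eqxx andbT; case: ifP => _.
  by rewrite inc_coef_basis /= xpair_eqE.
by rewrite andbF /inc_coef; case: insub => // w; rewrite ffunE.
Qed.

Lemma inc_scalerAl (a : k) f g : a *: (f * g) = (a *: f) * g.
Proof.
apply: inc_coefP => x z; rewrite inc_coefZ !inc_coefM mulr_sumr.
by apply: eq_bigr => y _; rewrite inc_coefZ mulrA.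
Qed.

Lemma inc_scalerAr (a : k) f g : a *: (f * g) = f * (a *: g).
Proof.
apply: inc_coefP => x z; rewrite inc_coefZ !inc_coefM mulr_sumr.
by apply: eq_bigr => y _; rewrite inc_coefZ mulrCA.
Qed.

End IncidenceAlgebra.

Section Ext1.
Context (R : pzRingType).

Definition short_exact (L M N : lmodType R)
    (i : {linear L -> M}) (p : {linear M -> N}) : Prop :=
  [/\ injective i, forall z, exists y, p y = z
    & forall y, p y = 0 <-> exists x, i x = y].

Definition isomorphic (M N : lmodType R) : Prop :=
  exists f : {linear M -> N}, bijective f.

Definition Hom_is_zero (M N : lmodType R) : Prop :=
  forall (f : {linear M -> N}) x, f x = 0.

Section Extensions.
Context (M N : lmodType R).

Record extension : Type := Extension {
  ext_mid : lmodType R;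
  ext_inj : {linear N -> ext_mid};
  ext_proj : {linear ext_mid -> M};
  ext_exact : short_exact ext_inj ext_proj
}.

Definition ext_equiv (E E' : extension) : Prop :=
  exists h : {linear ext_mid E -> ext_mid E'},
    [/\ bijective h, forall x, h (ext_inj E x) = ext_inj E' x
      & forall y, ext_proj E' (h y) = ext_proj E y].

Definition split_inj (x : N) : N * M := (x, 0).

Fact split_inj_is_linear : linear split_inj.
Proof.
by move=> a x y; rewrite /split_inj -[RHS]/(a *: x + y, a *: 0 + 0) scaler0 addr0.
Qed.

HB.instance Definition _ :=
  GRing.isLinear.Build R N (N * M)%type *:%R split_inj split_inj_is_linear.

Fact split_exact : short_exact split_inj (@snd N M).
Proof.
split=> [x y [] //|z|[x y]]; first by exists (0, z).
by split=> [/= ->|[x' [_ <-]] //]; exists x.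
Qed.

Definition split_extension : extension := Extension split_exact.

(* Yoneda's description of Ext^1(M, N): the equivalence classes of short exact
   sequences 0 -> N -> E -> M -> 0; the split class is the zero of the Baer sum. *)
Definition Ext1 : Type :=
  {C : extension -> Prop | exists E, C = ext_equiv E}.

Definition Ext1_class (E : extension) : Ext1 :=
  exist _ (ext_equiv E) (ex_intro _ E erefl).

Definition Ext1_zero : Ext1 := Ext1_class split_extension.

Definition Ext1_is_zero : Prop := forall c : Ext1, c = Ext1_zero.

End Extensions.
End Ext1.

Section TorsionPairs.
Context (A : pzRingType).

Definition finitely_generated (R : pzRingType) (M : lmodType R) : Prop :=
  exists n (g : 'I_n -> M), forall x, exists a : 'I_n -> R,
    x = \sum_i a i *: g i.

(* A right A-module is a left module over the converse ring A^c: the scalar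
   product a *: x stands for x a. *)
Record fg_module : Type := FgModule {
  fg_carrier :> lmodType A^c;
  fg_carrierP : finitely_generated fg_carrier
}.

Definition iso_closed (C : fg_module -> Prop) : Prop :=
  forall X Y : fg_module, isomorphic X Y -> C X -> C Y.

Definition is_torsion_pair (T F : fg_module -> Prop) : Prop :=
  [/\ iso_closed T, iso_closed F,
      forall X Y : fg_module, T X -> F Y -> Hom_is_zero X Y
    & forall X : fg_module, exists tX fX : fg_module,
        [/\ T tX, F fX & exists (i : {linear tX -> X}) (p : {linear X -> fX}),
                           short_exact i p]].

(* Under functional and propositional extensionality, Leibniz equality of these
   records amounts to equality of the two subcategories. *)
Record omega_torsion_pair : Type := OmegaTorsionPair {
  tp_torsion : fg_module -> Prop;
  tp_free : fg_module -> Prop;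
  tp_is_torsion_pair : is_torsion_pair tp_torsion tp_free;
  tp_Ext1 : forall X Y : fg_module,
    tp_torsion X -> tp_free Y -> Ext1_is_zero X Y
}.

Definition omega_le (p q : omega_torsion_pair) : Prop :=
  forall X, tp_torsion p X -> tp_torsion q X.

End TorsionPairs.

Section OrderIdeals.
Context (d : Order.disp_t) (Q : finPOrderType d).

Definition is_order_ideal : {pred {set Q}} := fun I : {set Q} =>
  [forall x in I, forall y : Q, (y <= x)%O ==> (y \in I)].

Lemma is_order_idealP (I : {set Q}) :
  reflect (forall x y : Q, x \in I -> (y <= x)%O -> y \in I)
          (I \in is_order_ideal).
Proof.
apply: (iffP forall_inP) => [idI x y xI yx|idI x xI].
  by have /forallP/(_ y)/implyP := idI _ xI; apply.
by apply/forallP => y; apply/implyP; apply: idI.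
Qed.

Fact order_ideal_meet :
  {in is_order_ideal &, forall I J, (I `&` J)%O \in is_order_ideal}.
Proof.
move=> I J /is_order_idealP idI /is_order_idealP idJ.
apply/is_order_idealP => x y /setIP[xI xJ] yx.
by apply/setIP; split; [apply: idI yx | apply: idJ yx].
Qed.

Fact order_ideal_join :
  {in is_order_ideal &, forall I J, (I `|` J)%O \in is_order_ideal}.
Proof.
move=> I J /is_order_idealP idI /is_order_idealP idJ.
apply/is_order_idealP => x y /setUP[xI|xJ] yx; apply/setUP.
  by left; apply: idI yx.
by right; apply: idJ yx.
Qed.

Fact order_ideal_bot : (\bot)%O \in is_order_ideal.
Proof. by apply/is_order_idealP => x y; rewrite inE. Qed.

Fact order_ideal_top : (\top)%O \in is_order_ideal.
Proof. by apply/is_order_idealP => x y; rewrite !inE. Qed.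

HB.instance Definition _ := Order.isTBLatticeClosed.Build _ {set Q}
  is_order_ideal order_ideal_meet order_ideal_join
  order_ideal_bot order_ideal_top.

Record order_ideal : Type := OrderIdeal {
  ideal_set :> {set Q};
  ideal_setP : ideal_set \in is_order_ideal
}.

HB.instance Definition _ := [isSub for ideal_set].
HB.instance Definition _ := [Finite of order_ideal by <:].
HB.instance Definition _ := [SubChoice_isTBSubLattice of order_ideal by <:
  with Order.SetSubsetOrder.subset_display].

Fact order_ideal_meetUl :
  @left_distributive order_ideal order_ideal Order.meet Order.join.
Proof.
by move=> I J K; apply: val_inj; apply: meetUl.
Qed.

HB.instance Definition _ :=
  Order.Lattice_Meet_isDistrLattice.Build _ order_ideal order_ideal_meetUl.

Lemma le_order_ideal (I J : order_ideal) :
  (I <= J)%O = (ideal_set I \subset ideal_set J).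
Proof. by []. Qed.

End OrderIdeals.

(* Main.v *)
Require Import Defs.
From HB Require Import structures.
From mathcomp Require Import all_boot all_order all_algebra.
From mathcomp Require Import boolp.

Set Implicit Arguments.
Unset Strict Implicit.
Unset Printing Implicit Defensive.

Import Order.TTheory GRing.Theory.

Local Open Scope ring_scope.

(** A right module X over the incidence algebra A is a representation of P: the
    space X_x = X e_x sits at x, and e_{x,y} maps X_x to X_y whenever x <= y.
    For a subset C of P write e_C for the sum of the e_x with x in C, and say
    that X is supported on C when X_x = 0 for x outside C.  The bijection sends
    (T, F) to I = {x | S_x is in T}, where S_x is the simple module at x, and its
    inverse sends an upper set I (that is, an order ideal of the opposite poset)
    to (modules supported on I, modules supported on the complement of I).

    From a pair to an upper set.  As S_x is simple, it lies in T or in F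
    ([simple_torsion_or_free]).  If y covers x there is a nonsplit extension of
    S_x by S_y, with basis v, v e_{x,y}, so S_x in T excludes S_y in F
    ([cover_Ext1]); going up along covers, I is an upper set
    ([torsion_set_upper]).

    The set determines the pair.  If x is maximal among the points where Y does
    not vanish, then S_x embeds into Y; if x is minimal among the points where X
    does not vanish and X is finitely generated, then X maps onto S_x
    ([vanishes_of_hom_from_simple], [vanishes_of_hom_to_simple]).  Since
    Hom(T, F) = 0, a module in F that is nonzero somewhere on I is impossible:
    take x maximal there.  Dually a module in T is supported on I
    ([torsion_supported], [free_supported]).  The canonical sequence
    0 -> tX -> X -> fX -> 0 then gives both converses: if X is supported on I, so
    is its quotient fX, which is also supported on the complement, hence zero
    ([tp_torsionE], [tp_freeE]).

    From an upper set to a pair.  When I is an upper set, e_I A (1 - e_I) = 0, so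
    X e_I is a submodule of X and X (1 - e_I) carries the quotient structure
    ([corner_short_exact]).  In an extension of X by Y, with X supported on I and
    Y on the complement, multiplication by 1 - e_I is a linear retraction onto Y,
    so that the extension splits ([supported_Ext1]). *)

(** * Linear maps and short exact sequences *)

Section LinearMaps.
Context (R : pzRingType).

Lemma linear_exists (M N : lmodType R) (g : M -> N) :
  linear g -> exists f : {linear M -> N}, f =1 g.
Proof.
move=> gL; pose g' : M -> N := g.
pose f : {linear M -> N} :=
  HB.pack g' (GRing.isLinear.Build R M N *:%R g' gL).
by exists f.
Qed.

Lemma bijective_of_inj_surj (S T : Type) (f : S -> T) :
  injective f -> (forall y, exists x, f x = y) -> bijective f.
Proof.
move=> fI /choice[g gK]; exists g => // x.
by apply: fI; rewrite gK.
Qed.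

Lemma inverse_linear (M N : lmodType R) (f : {linear M -> N}) :
  bijective f -> exists g : {linear N -> M}, cancel f g /\ cancel g f.
Proof.
move=> [g0 fK gK].
have [|g gE] := @linear_exists N M g0.
  by move=> a x y; apply: (can_inj fK); rewrite gK linearP !gK.
by exists g; split=> x; rewrite gE.
Qed.

Lemma isomorphic_sym (M N : lmodType R) : isomorphic M N -> isomorphic N M.
Proof. by case=> f /inverse_linear[g [fK gK]]; exists g; exists f. Qed.

Lemma short_exact_inj_iso (L M N : lmodType R) (i : {linear L -> M})
    (p : {linear M -> N}) :
  short_exact i p -> (forall z : N, z = 0) -> isomorphic L M.
Proof.
move=> [iI _ ipE] N0; exists i; apply: bijective_of_inj_surj => // y.
exact/ipE/N0.
Qed.

Lemma short_exact_proj_iso (L M N : lmodType R) (i : {linear L -> M})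
    (p : {linear M -> N}) :
  short_exact i p -> (forall x : L, x = 0) -> isomorphic M N.
Proof.
move=> [_ pS ipE] L0; exists p; apply: bijective_of_inj_surj => //.
apply: raddf_inj => y /ipE[x <-]; by rewrite (L0 x) linear0.
Qed.

End LinearMaps.

(** * The Yoneda description of Ext^1 *)

Section Ext1Theory.
Context (R : pzRingType) (M N : lmodType R).
Implicit Types E : extension M N.

Lemma ext_equiv_refl E : ext_equiv E E.
Proof. by exists idfun; split=> //; exists id. Qed.

Lemma ext_equiv_sym E E' : ext_equiv E E' -> ext_equiv E' E.
Proof.
move=> [h [/inverse_linear[g [hK gK]] hi hp]]; exists g; split.
- by exists h.
- by move=> x; rewrite -hi hK.
- by move=> y; rewrite -hp gK.
Qed.

Lemma ext_equiv_trans E1 E2 E3 :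
  ext_equiv E1 E2 -> ext_equiv E2 E3 -> ext_equiv E1 E3.
Proof.
move=> [h [hB hi hp]] [h' [hB' hi' hp']].
exists (h' \o h : {linear _ -> _}); split.
- exact: bij_comp.
- by move=> x /=; rewrite hi hi'.
- by move=> y /=; rewrite hp' hp.
Qed.

(** Elements of Ext1 are equivalence classes encoded as predicates, so the
    equality of two of them comes down to equivalence by extensionality. *)
Lemma Ext1_is_zeroP :
  Ext1_is_zero M N <-> forall E, ext_equiv E (split_extension M N).
Proof.
split=> [E0 E|spl [C CE]].
  have /(congr1 sval)/= EE := E0 (Ext1_class E).
  rewrite EE; exact: ext_equiv_refl.
case: (CE) => E def_C; apply: eq_exist; rewrite def_C.
apply/funext => E'; apply/propext; split.
  exact: ext_equiv_trans (ext_equiv_sym (spl E)).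
exact: ext_equiv_trans (spl E).
Qed.

End Ext1Theory.

(** * Maximal elements *)

(** Replacing x0 by a larger point that satisfies Q shrinks the set of points
    above it, so this process stops.  Minimal elements are obtained by applying
    the lemma to the opposite order. *)
Lemma exists_maximal (d : Order.disp_t) (P : finPOrderType d) (Q : P -> Prop)
    (x0 : P) :
  Q x0 -> exists x, Q x /\ forall y, (x < y)%O -> ~ Q y.
Proof.
have [n] := ubnP #|[set y | (x0 < y)%O]|; elim: n x0 => // n IHn x0.
rewrite ltnS => le_n Qx0.
have [[y [xy Qy]]|nQ] := EM (exists y, (x0 < y)%O /\ Q y); last first.
  by exists x0; split=> // y xy Qy; apply: nQ; exists y.
apply: (IHn y) Qy; apply: leq_trans le_n; apply: proper_card.
apply/properP; split; last by exists y; rewrite !inE ?ltxx.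
by apply/subsetP => z; rewrite !inE; apply: lt_trans.
Qed.

(** * Idempotents of the incidence algebra and supports of modules *)

Section IncidenceModules.
Context (k : fieldType) (d : Order.disp_t) (P : finPOrderType d).

Local Notation A := (incidence_algebra k P).
Implicit Types (a b : A) (C D : {set P}) (x y z : P).

Definition set_idem C : A :=
  [ffun u : Defs.interval P =>
     (((val u).1 == (val u).2) && ((val u).1 \in C))%:R].

Lemma inc_coef0 x y : inc_coef (0 : A) x y = 0.
Proof. by rewrite -(scale0r (0 : A)) inc_coefZ mul0r. Qed.

Lemma inc_coef_set_idem C x y :
  inc_coef (set_idem C) x y = ((x == y) && (x \in C))%:R.
Proof.
rewrite /inc_coef; case: insubP => [u _ uE|/= xy]; first by rewrite ffunE uE.
by case: eqP xy => // ->; rewrite lexx.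
Qed.

Lemma inc_coef_set_idemMl C a x y :
  inc_coef (set_idem C * a) x y = (x \in C)%:R * inc_coef a x y.
Proof.
rewrite inc_coefM (bigD1 x) //= inc_coef_set_idem eqxx big1 ?addr0 // => z zx.
by rewrite inc_coef_set_idem eq_sym (negPf zx) mul0r.
Qed.

Lemma inc_coef_set_idemMr C a x y :
  inc_coef (a * set_idem C) x y = inc_coef a x y * (y \in C)%:R.
Proof.
rewrite inc_coefM (bigD1 y) //= inc_coef_set_idem eqxx big1 ?addr0 // => z zy.
by rewrite inc_coef_set_idem (negPf zy) mulr0.
Qed.

Lemma set_idemM C : set_idem C * set_idem C = set_idem C.
Proof.
apply: inc_coefP => x y; rewrite inc_coef_set_idemMl inc_coef_set_idem.
by rewrite -natrM mulnb andbCA andbb.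
Qed.

Lemma set_idemC C : set_idem C + set_idem (~: C) = 1.
Proof.
apply: inc_coefP => x y; rewrite inc_coefD !inc_coef_set_idem inE inc_coef1.
by rewrite -natrD; case: eqP => //= _; case: (x \in C).
Qed.

Lemma set_idemMC C : set_idem C * set_idem (~: C) = 0.
Proof.
have -> : set_idem (~: C) = 1 - set_idem C.
  by rewrite -(set_idemC C) addrAC subrr add0r.
by rewrite mulrBr mulr1 set_idemM subrr.
Qed.

Lemma set_idem_sum C : set_idem C = \sum_(x in C) set_idem [set x].
Proof.
apply: inc_coefP => x y; rewrite inc_coef_set_idem.
have -> : inc_coef (\sum_(z in C) set_idem [set z]) x y =
    \sum_(z in C) inc_coef (set_idem [set z]) x y.
  by apply: (big_morph (fun a : A => inc_coef a x y)) => [a b|];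
    rewrite ?inc_coefD ?inc_coef0.
under eq_bigr do rewrite inc_coef_set_idem inE.
have [_|_] := eqVneq x y; last by rewrite big1.
have [xC|xC] := boolP (x \in C); last first.
  by rewrite big1 // => z zC; case: eqP => // xz; rewrite xz zC in xC.
rewrite (bigD1 x) //= eqxx big1 ?addr0 // => z /andP[_ zx].
by rewrite eq_sym (negPf zx).
Qed.

Lemma set_idem1E x a :
  set_idem [set x] * a * set_idem [set x] = inc_coef a x x *: set_idem [set x].
Proof.
apply: inc_coefP => y z; rewrite inc_coefZ inc_coef_set_idemMr.
rewrite inc_coef_set_idemMl inc_coef_set_idem !inE.
have [->|] := eqVneq y x; last by rewrite !mul0r andbF mulr0.
by rewrite andbT mul1r eq_sym; case: eqP => [->|_]; rewrite ?mulr0.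
Qed.

Definition upper_set C := forall x y, x \in C -> (x <= y)%O -> y \in C.

(** No e_{x,y} leads out of an upper set C, so X e_C is a submodule of every
    right module X. *)
Lemma upper_set_idem C a :
  upper_set C -> set_idem C * a * set_idem (~: C) = 0.
Proof.
move=> Cup; apply: inc_coefP => x y.
rewrite inc_coef_set_idemMr inc_coef_set_idemMl inc_coef0 inE.
have [xC|] := boolP (x \in C); last by rewrite !mul0r.
have [xy|xy] := boolP (x <= y)%O; last by rewrite inc_coef_out // mulr0 mul0r.
by rewrite (Cup _ _ xC xy) mulr0.
Qed.

Definition convex_set C :=
  forall x y z, x \in C -> z \in C -> (x <= y)%O -> (y <= z)%O -> y \in C.

Lemma upper_set_convex C : upper_set C -> convex_set C.
Proof. by move=> Cup x y z xC _ xy _; apply: Cup xC xy. Qed.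

Lemma upper_setC_convex C : upper_set C -> convex_set (~: C).
Proof.
by move=> Cup x y z _ + _ yz; rewrite !inE; apply: contra => /Cup; apply.
Qed.

(** A path from C to C passes only through C: this makes a |-> e_C a e_C
    multiplicative. *)
Lemma convex_set_idem C a b : convex_set C ->
  set_idem C * (a * b * set_idem C) =
  set_idem C * (a * set_idem C * (b * set_idem C)).
Proof.
move=> Ccv; apply: inc_coefP => x z.
rewrite !inc_coef_set_idemMl inc_coef_set_idemMr !inc_coefM.
have [xC|] := boolP (x \in C); last by rewrite !mul0r.
rewrite mulr_suml; congr (_ * _); apply: eq_bigr => y _.
rewrite !inc_coef_set_idemMr.
have [zC|] := boolP (z \in C); last by rewrite !mulr0.
have [yC|yC] := boolP (y \in C); first by rewrite !mulr1.
rewrite mulr1 mulr0 mul0r; have [xy|xy] := boolP (x <= y)%O; last first.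
  by rewrite inc_coef_out // mul0r.
rewrite [inc_coef b _ _]inc_coef_out ?mulr0 //.
by apply: contra yC => yz; apply: Ccv xC zC xy yz.
Qed.

(** * Right modules *)

(** Left scaling by the converse ring, written on the right so that [ractM] has
    the order of multiplication in A. *)
Definition ract (X : lmodType A^c) (v : X) (a : A) : X := (a : A^c) *: v.

Local Notation "v ** a" := (ract v a) (at level 40, left associativity).

Section RightAction.
Context (X : lmodType A^c).
Implicit Types v w : X.

Lemma ractM v a b : v ** (a * b) = v ** a ** b.
Proof. by rewrite /ract scalerA. Qed.

Lemma ract1 v : v ** 1 = v. Proof. exact: scale1r. Qed.

Lemma ract0r v : v ** 0 = 0. Proof. exact: scale0r. Qed.

Lemma ract0l a : (0 : X) ** a = 0. Proof. exact: scaler0. Qed.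

Lemma ractDr v a b : v ** (a + b) = v ** a + v ** b.
Proof. exact: scalerDl. Qed.

Lemma ractDl v w a : (v + w) ** a = v ** a + w ** a.
Proof. exact: scalerDr. Qed.

Lemma ractBl v w a : (v - w) ** a = v ** a - w ** a.
Proof. exact: scalerBr. Qed.

Lemma ract_suml (I : finType) (F : I -> X) a :
  (\sum_i F i) ** a = \sum_i F i ** a.
Proof. exact: scaler_sumr. Qed.

Lemma ract_sumr (I : finType) (Q : pred I) v (F : I -> A) :
  v ** (\sum_(i | Q i) F i) = \sum_(i | Q i) v ** F i.
Proof.
by apply: (big_morph (ract v)) => [a b|]; rewrite ?ractDr ?ract0r.
Qed.

Lemma ract_set_idemC C v : v ** set_idem C + v ** set_idem (~: C) = v.
Proof. by rewrite -ractDr set_idemC ract1. Qed.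

(** A module carries only its A-action; k acts through the scalars of A. *)
Definition kscale (c : k) v : X := v ** (c *: (1 : A)).

Lemma ract_kscale (c : k) v a : v ** (c *: a) = kscale c (v ** a).
Proof. by rewrite /kscale -ractM -inc_scalerAr mulr1. Qed.

Lemma kscale_ract (c : k) v a : kscale c v ** a = kscale c (v ** a).
Proof. by rewrite /kscale -!ractM -inc_scalerAr -inc_scalerAl mulr1 mul1r. Qed.

Lemma kscaleA (c c' : k) v : kscale c (kscale c' v) = kscale (c * c') v.
Proof.
rewrite /kscale -ractM; congr (_ ** _).
by rewrite -inc_scalerAl mul1r scalerA mulrC.
Qed.

Lemma kscale1 v : kscale 1 v = v.
Proof. by rewrite /kscale scale1r ract1. Qed.

Lemma kscale0 v : kscale 0 v = 0.
Proof. by rewrite /kscale scale0r ract0r. Qed.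

Lemma kscaleDl (c c' : k) v : kscale (c + c') v = kscale c v + kscale c' v.
Proof. by rewrite /kscale scalerDl ractDr. Qed.

Lemma kscaleB (c c' : k) v : kscale (c - c') v = kscale c v - kscale c' v.
Proof.
by apply/eqP; rewrite eq_sym subr_eq -kscaleDl subrK.
Qed.

Lemma kscale_suml (I : finType) (F : I -> X) c :
  kscale c (\sum_i F i) = \sum_i kscale c (F i).
Proof. exact: ract_suml. Qed.

End RightAction.

Lemma linear_ract (X Y : lmodType A^c) (f : {linear X -> Y}) (v : X) a :
  f (v ** a) = f v ** a.
Proof. exact: linearZ. Qed.

Lemma ract_linear (X Y : lmodType A^c) (f : X -> Y) :
  (forall v w, f (v + w) = f v + f w) ->
  (forall v a, f (v ** a) = f v ** a) -> linear f.
Proof. by move=> fD fM a v w; rewrite fD; congr (_ + _); apply: fM. Qed.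

(** * Supports *)

Definition vanishes_at (X : lmodType A^c) x :=
  forall v : X, v ** set_idem [set x] = 0.

Definition supported (X : lmodType A^c) C :=
  forall x, x \notin C -> vanishes_at X x.

Lemma supported_idem (X : lmodType A^c) C (v : X) :
  supported X C -> v ** set_idem C = v.
Proof.
move=> XC; rewrite -[RHS](ract_set_idemC C) [in X in _ + X]set_idem_sum.
rewrite ract_sumr big1 ?addr0 // => x; rewrite inE => /XC; exact.
Qed.

Lemma idem_supported (X : lmodType A^c) C :
  (forall v : X, v ** set_idem C = v) -> supported X C.
Proof.
move=> vC x xC v; rewrite -(vC v) -ractM.
have -> : set_idem C * set_idem [set x] = 0; last exact: ract0r.
apply: inc_coefP => y z; rewrite inc_coef_set_idemMl inc_coef_set_idem inc_coef0.
rewrite inE; have [->|_] := eqVneq y x; last by rewrite andbF mulr0.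
by rewrite (negPf xC) mul0r.
Qed.

Lemma set_idem1_out x y a : ~~ (x <= y)%O ->
  set_idem [set x] * a * set_idem [set y] = 0.
Proof.
move=> xy; apply: inc_coefP => z t.
rewrite inc_coef_set_idemMr inc_coef_set_idemMl inc_coef0 !inE.
have [->|_] := eqVneq z x; last by rewrite !mul0r.
have [->|_] := eqVneq t y; last by rewrite mulr0.
by rewrite inc_coef_out // mulr0 mul0r.
Qed.

(** In v e_x a, every component at some y > x lies in X_y = 0, and a only
    contributes its diagonal coefficient: X_x is a submodule of X, a sum of copies of
    the simple module at x. *)
Lemma ract_maximal (X : lmodType A^c) x (v : X) a :
  (forall y, (x < y)%O -> vanishes_at X y) ->
  v ** set_idem [set x] ** a = kscale (inc_coef a x x) (v ** set_idem [set x]).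
Proof.
move=> Xx; rewrite -ract_kscale -set_idem1E.
rewrite -[LHS](ract_set_idemC [set x]) -!ractM !mulrA.
rewrite [_ (~: _)]set_idem_sum mulr_sumr [in X in _ + X]ract_sumr.
rewrite big1 ?addr0 //.
move=> y; rewrite !inE => yx; have [xy|xy] := boolP (x <= y)%O.
  by rewrite ractM Xx // lt_neqAle eq_sym yx.
by rewrite set_idem1_out // ract0r.
Qed.

(** Dual to [ract_maximal]: the component of v a at x only receives
    contributions from X_y with y <= x, so X_x is a quotient of X, a sum of copies
    of the simple module at x. *)
Lemma ract_minimal (X : lmodType A^c) x (v : X) a :
  (forall y, (y < x)%O -> vanishes_at X y) ->
  v ** a ** set_idem [set x] = kscale (inc_coef a x x) (v ** set_idem [set x]).
Proof.
move=> Xx; rewrite -ract_kscale -set_idem1E.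
rewrite -{1}[v](ract_set_idemC [set x]) 2!ractDl -!ractM.
rewrite [_ (~: _)]set_idem_sum !mulr_suml [in X in _ + X]ract_sumr.
rewrite big1 ?addr0 ?mulrA //.
move=> y; rewrite !inE => yx; have [xy|xy] := boolP (y <= x)%O.
  by rewrite ractM Xx ?ract0l // lt_neqAle yx.
by rewrite mulrA set_idem1_out // ract0r.
Qed.

(** * Simple modules *)

(** The point x indexes the type because the action on k depends on it. *)
Definition simple_mod x : Type := k.

HB.instance Definition _ x := GRing.Zmodule.copy (simple_mod x) k.

Section SimpleModule.
Context (x : P).

Definition simple_scale (a : A^c) (t : simple_mod x) : simple_mod x :=
  (inc_coef (a : A) x x * t : k).

Fact simple_scaleA (a b : A^c) t :
  simple_scale a (simple_scale b t) = simple_scale (a * b) t.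
Proof.
rewrite /simple_scale mulrA; congr (_ * _).
rewrite [RHS](@inc_coefM _ _ _ (b : A) (a : A) x x).
rewrite (bigD1 x) //= mulrC big1 ?addr0 // => y yx.
have [xy|xy] := boolP (x <= y)%O; last by rewrite inc_coef_out // mul0r.
rewrite [X in _ * X]inc_coef_out ?mulr0 //.
by apply: contra yx => yx; rewrite eq_le xy yx.
Qed.

Fact simple_scale1 : left_id 1 simple_scale.
Proof.
by move=> t; rewrite /simple_scale [inc_coef _ _ _]inc_coef1 eqxx mul1r.
Qed.

Fact simple_scaleDr : right_distributive simple_scale +%R.
Proof. by move=> a s t; apply: mulrDr. Qed.

Fact simple_scaleDl t : {morph simple_scale^~ t : a b / a + b}.
Proof. by move=> a b; rewrite /simple_scale inc_coefD; apply: mulrDl. Qed.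

HB.instance Definition _ := GRing.Zmodule_isLmodule.Build A^c (simple_mod x)
  simple_scaleA simple_scale1 simple_scaleDr simple_scaleDl.

Lemma simple_ract (t : simple_mod x) a :
  t ** a = (inc_coef a x x * (t : k) : k).
Proof. by []. Qed.

Lemma simple_cyclic (s t : simple_mod x) : s != 0 -> exists a, s ** a = t.
Proof.
move=> s0; exists ((t : k) / (s : k) *: (1 : A)).
by rewrite simple_ract inc_coefZ inc_coef1 eqxx mulr1; apply: divfK.
Qed.

Lemma simple_fg : finitely_generated (simple_mod x).
Proof.
exists 1%N, (fun=> (1 : k) : simple_mod x) => t.
have [a <-] := @simple_cyclic (1 : k) t (oner_neq0 k).
by exists (fun=> a); rewrite big_ord1.
Qed.

Definition simple_fgmod : fg_module A := FgModule simple_fg.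

Lemma simple_idem C (t : simple_mod x) :
  t ** set_idem C = ((x \in C)%:R * (t : k) : k).
Proof. by rewrite simple_ract inc_coef_set_idem eqxx. Qed.

Lemma supported_simple C : supported (simple_mod x) C <-> x \in C.
Proof.
split=> [sC|xC y yC t].
  apply: contraT => /sC/(_ (1 : k)); rewrite simple_idem inE eqxx mul1r.
  by move/eqP; rewrite oner_eq0.
rewrite simple_idem inE; case: eqP yC => [<-|_ _]; first by rewrite xC.
exact: mul0r.
Qed.

(** A vector w of X_x at a maximal point x of the support spans a copy of the
    simple module, as the image of t |-> t w. *)
Lemma vanishes_of_hom_from_simple (Y : lmodType A^c) :
  (forall y, (x < y)%O -> vanishes_at Y y) -> Hom_is_zero (simple_mod x) Y ->
  vanishes_at Y x.
Proof.
move=> Yx hom0 v; set w := v ** _.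
have [|f fE] := @linear_exists _ (simple_mod x) Y (fun t => kscale (t : k) w).
  apply: ract_linear => [s t|t a]; first exact: kscaleDl.
  by rewrite simple_ract kscale_ract ract_maximal // kscaleA mulrC.
by rewrite -(kscale1 w) -(fE (1 : k)) hom0.
Qed.

End SimpleModule.

(** * Linear functionals on finitely generated modules *)

Lemma inc_ract_sum (X : lmodType A^c) (v : X) a :
  v ** a = \sum_u kscale (a u) (v ** inc_basis k u).
Proof.
rewrite {1}[a]inc_basis_sum ract_sumr; apply: eq_bigr => u _.
exact: ract_kscale.
Qed.

Lemma fg_kspan (X : lmodType A^c) :
  finitely_generated X <->
  exists n (g : 'I_n -> X), forall v, exists c : 'I_n -> k,
    v = \sum_i kscale (c i) (g i).
Proof.
split=> [[n [g gS]]|[n [g gS]]]; last first.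
  exists n, g => v; have [c ->] := gS v.
  by exists (fun i => (c i *: (1 : A))).
pose I := ('I_n * Defs.interval P)%type.
exists #|{: I}|, (fun j => g (enum_val j).1 ** inc_basis k (enum_val j).2) => v.
have [a ->] := gS v.
exists (fun j => (a (enum_val j).1 : A) (enum_val j).2).
rewrite -(big_enum_val
  (fun q : I => kscale ((a q.1 : A) q.2) (g q.1 ** inc_basis k q.2))) /=.
rewrite -(pair_bigA _
  (fun i u => kscale ((a i : A) u) (g i ** inc_basis k u))) /=.
by apply: eq_bigr => i _; apply: inc_ract_sum.
Qed.

(** X_x is finite dimensional, hence has a nonzero functional as soon as it is
    nonzero, and [ract_minimal] turns that functional into a linear map to the
    simple module.  The functional is the first coordinate with respect to a
    family that spans X_x and has minimal length: minimality makes the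
    coordinate unique, hence additive, and not identically zero. *)
Lemma vanishes_of_hom_to_simple (X : lmodType A^c) x :
  finitely_generated X -> (forall y, (y < x)%O -> vanishes_at X y) ->
  Hom_is_zero X (simple_mod x) -> vanishes_at X x.
Proof.
move=> /fg_kspan Xfg Xx hom0.
pose spans n (g : 'I_n -> X) := forall v, exists c : 'I_n -> k,
  v ** set_idem [set x] = \sum_i kscale (c i) (g i).
have exn : exists n, `[< exists g, spans n g >].
  have [n [g gS]] := Xfg; exists n; apply/asboolP; exists g => v.
  exact: gS.
case: (ex_minnP exn) => -[|m] /asboolP[g gS] gmin.
  by move=> v; have [c ->] := gS v; rewrite big_ord0.
have nospan : ~ spans m (g \o lift ord0).
  move=> gS'; suff /gmin : `[< exists g, spans m g >] by rewrite ltnn.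
  by apply/asboolP; exists (g \o lift ord0).
have uniq_coord (c c' : 'I_m.+1 -> k) :
    \sum_i kscale (c i) (g i) = \sum_i kscale (c' i) (g i) ->
    c ord0 = c' ord0.
  move=> cc'; apply/eqP; rewrite -subr_eq0; apply/negPn/negP => nz.
  set e := c ord0 - c' ord0 in nz.
  apply: nospan => v; have [b bE] := gS v.
  exists (fun i => b (lift ord0 i) -
      b ord0 / e * (c (lift ord0 i) - c' (lift ord0 i))).
  (* A relation with first coefficient e <> 0 eliminates g ord0. *)
  have rel : \sum_i kscale (c i - c' i) (g i) = 0.
    under eq_bigr do rewrite kscaleB.
    by rewrite sumrB cc' subrr.
  have -> : v ** set_idem [set x] = \sum_i kscale (b i) (g i) -
      kscale (b ord0 / e) (\sum_i kscale (c i - c' i) (g i)).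
    by rewrite rel [kscale _ 0]ract0l subr0.
  rewrite kscale_suml -sumrB big_ord_recl kscaleA -/e divfK // subrr add0r.
  by apply: eq_bigr => i _; rewrite kscaleA -kscaleB.
have [c cE] := choice gS.
have [|f fE] := @linear_exists _ X (simple_mod x) (fun v => c v ord0).
  apply: ract_linear => [v w|v a].
    apply: (uniq_coord _ (fun i => c v i + c w i)).
    rewrite -cE ractDl !cE -big_split.
    by apply: eq_bigr => i _; rewrite kscaleDl.
  rewrite simple_ract; apply: (uniq_coord _ (fun i => inc_coef a x x * c v i)).
  rewrite -cE ract_minimal // cE kscale_suml.
  by apply: eq_bigr => i _; rewrite kscaleA.
case: nospan => v; exists (c v \o lift ord0).
by rewrite cE big_ord_recl -[c v ord0]fE hom0 kscale0 add0r.
Qed.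

(** * Extensions of simple modules along covers *)

Section CoverModule.
Context (x y : P) (xy : (x < y)%O).

Definition no_point_between := forall z, (x < z)%O -> (z < y)%O -> False.

(** Basis v_x, v_y with v_x e_{x,y} = v_y.  The action is associative only when
    nothing lies strictly between x and y, so that proof indexes the type. *)
Definition cover_mod (_ : no_point_between) : Type := (k * k)%type.

Context (cov : no_point_between).

HB.instance Definition _ := GRing.Zmodule.copy (cover_mod cov) (k * k)%type.

Definition cover_scale (a : A^c) (v : cover_mod cov) : cover_mod cov :=
  (inc_coef (a : A) x x * v.1,
   inc_coef (a : A) x y * v.1 + inc_coef (a : A) y y * v.2).

Lemma inc_coefM_diag z a b :
  inc_coef (a * b) z z = inc_coef a z z * inc_coef b z z.
Proof.
rewrite inc_coefM (bigD1 z) //= big1 ?addr0 // => t tz.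
have [zt|zt] := boolP (z <= t)%O; last by rewrite inc_coef_out // mul0r.
rewrite [X in _ * X]inc_coef_out ?mulr0 //.
by apply: contra tz => tz; rewrite eq_le zt tz.
Qed.

Lemma inc_coefM_cover a b :
  inc_coef (a * b) x y =
  inc_coef a x x * inc_coef b x y + inc_coef a x y * inc_coef b y y.
Proof.
rewrite inc_coefM (bigD1 x) //= (bigD1 y) ?gt_eqF //=.
rewrite big1 ?addr0 // => t /andP[tx ty].
have [xt|xt] := boolP (x <= t)%O; last by rewrite inc_coef_out // mul0r.
rewrite [X in _ * X]inc_coef_out ?mulr0 //; apply/negP => t_y.
by apply: (cov (z := t)); rewrite lt_neqAle ?ty ?t_y // eq_sym tx.
Qed.

Fact cover_scaleA (a b : A^c) v :
  cover_scale a (cover_scale b v) = cover_scale (a * b) v.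
Proof.
rewrite /cover_scale /= (inc_coefM_diag x (b : A) a).
rewrite (inc_coefM_diag y (b : A) a) (inc_coefM_cover (b : A) a).
congr (_, _); first by rewrite mulrCA mulrA.
rewrite mulrDl mulrDr !mulrA -addrA; congr (_ + _).
  by rewrite [_ * inc_coef _ x x]mulrC.
by congr (_ * _ + _ * _); rewrite mulrC.
Qed.

Fact cover_scale1 : left_id 1 cover_scale.
Proof.
case=> s t; rewrite /cover_scale /= ![inc_coef _ _ _]inc_coef1 !eqxx.
by rewrite lt_eqF // mul0r add0r !mul1r.
Qed.

Fact cover_scaleDr : right_distributive cover_scale +%R.
Proof.
by move=> a s t; rewrite /cover_scale /= !mulrDr; congr (_, _); rewrite addrACA.
Qed.

Fact cover_scaleDl t : {morph cover_scale^~ t : a b / a + b}.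
Proof.
move=> a b; rewrite /cover_scale !inc_coefD !mulrDl; congr (_, _).
by rewrite addrACA.
Qed.

HB.instance Definition _ := GRing.Zmodule_isLmodule.Build A^c (cover_mod cov)
  cover_scaleA cover_scale1 cover_scaleDr cover_scaleDl.

Definition cover_inj (t : simple_mod y) : cover_mod cov := (0, t : k).
Definition cover_proj (v : cover_mod cov) : simple_mod x := v.1.

Fact cover_inj_linear : linear cover_inj.
Proof.
apply: ract_linear => [s t|t a]; first by congr (_, _); rewrite addr0.
by congr (_, _); rewrite /= mulr0 ?add0r.
Qed.

Fact cover_proj_linear : linear cover_proj.
Proof. exact: ract_linear. Qed.

HB.instance Definition _ := GRing.isLinear.Build A^c (simple_mod y)
  (cover_mod cov) *:%R cover_inj cover_inj_linear.
HB.instance Definition _ := GRing.isLinear.Build A^c (cover_mod cov)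
  (simple_mod x) *:%R cover_proj cover_proj_linear.

Fact cover_exact : short_exact cover_inj cover_proj.
Proof.
split=> [s t []|t|[s t]] //; first by exists ((t : k), 0).
split=> [|[t' <-] //]; rewrite /cover_proj /= => ->.
by exists t.
Qed.

(** In a split extension of the simple modules at x and y, e_{x,y} acts as zero;
    here it maps the first basis vector to the second. *)
Lemma cover_Ext1 : ~ Ext1_is_zero (simple_mod x) (simple_mod y).
Proof.
move/Ext1_is_zeroP/(_ (Extension cover_exact)) => [h [_ hi hp]].
pose e := inc_basis k (exist (fun q => q.1 <= q.2)%O (x, y) (ltW xy)).
pose v : cover_mod cov := (1, 0).
have ve : v ** e = cover_inj (1 : k).
  rewrite [LHS]/(cover_scale _ _) /cover_scale !inc_coef_basis /= !xpair_eqE.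
  by rewrite !eqxx (lt_eqF xy) !(gt_eqF xy) /= !mul0r mulr1 addr0.
have := congr1 h ve; rewrite linear_ract => hve.
have /(congr1 (fun q => q.1 : k))/= := etrans hve (hi (1 : k)).
rewrite [LHS]simple_ract inc_coef_basis /= xpair_eqE (gt_eqF xy) mul0r.
by move/esym/eqP; rewrite oner_eq0.
Qed.

End CoverModule.

(** * Restriction of a module to a convex set *)

Section Corner.
Context (X : lmodType A^c) (C : {set P}).

Definition corner_pred : {pred X} := fun v => v ** set_idem C == v.

Fact corner_zmod_closed : zmod_closed corner_pred.
Proof.
split=> [|v w]; rewrite !unfold_in /corner_pred ?ract0l //.
by rewrite ractBl => /eqP-> /eqP->.
Qed.

HB.instance Definition _ :=
  GRing.isZmodClosed.Build X corner_pred corner_zmod_closed.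

(** The space X e_C, on which a acts as e_C a e_C.  For an upper set C it is a
    submodule of X, for a lower set a quotient; both are instances of the convex
    case, which thus avoids forming quotients.  The proof of convexity, needed
    for associativity, indexes the type. *)
Definition corner (_ : convex_set C) : Type := {v : X | v \in corner_pred}.

Context (Ccv : convex_set C).

HB.instance Definition _ :=
  [isSub of corner Ccv for @sval X (fun v => v \in corner_pred)].
HB.instance Definition _ := [Choice of corner Ccv by <:].
HB.instance Definition _ := [SubChoice_isSubZmodule of corner Ccv by <:].

Implicit Types v w : corner Ccv.

Lemma corner_idem v : val v ** set_idem C = val v.
Proof. exact/eqP/(valP v). Qed.

Fact to_corner_subproof (v : X) : v ** set_idem C \in corner_pred.
Proof. by rewrite unfold_in /corner_pred -ractM set_idemM. Qed.

Definition to_corner (v : X) : corner Ccv :=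
  exist _ (v ** set_idem C) (to_corner_subproof v).

Definition corner_scale (a : A^c) v : corner Ccv := to_corner (val v ** a).

Fact corner_scaleA (a b : A^c) v :
  corner_scale a (corner_scale b v) = corner_scale (a * b) v.
Proof.
apply: val_inj; rewrite /= -corner_idem -!ractM mulrA mulrA.
rewrite [a * b]/((b : A) * (a : A)) convex_set_idem //.
by rewrite !mulrA.
Qed.

Fact corner_scale1 : left_id 1 corner_scale.
Proof. by move=> v; apply: val_inj; rewrite /= ract1 corner_idem. Qed.

Fact corner_scaleDr : right_distributive corner_scale +%R.
Proof. by move=> a v w; apply: val_inj; rewrite /= !ractDl. Qed.

Fact corner_scaleDl v : {morph corner_scale^~ v : a b / a + b}.
Proof. by move=> a b; apply: val_inj; rewrite /= ractDr ractDl. Qed.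

HB.instance Definition _ := GRing.Zmodule_isLmodule.Build A^c (corner Ccv)
  corner_scaleA corner_scale1 corner_scaleDr corner_scaleDl.

Lemma val_corner_ract v a : val (v ** a) = val v ** a ** set_idem C.
Proof. by []. Qed.

Lemma corner_supported : supported (corner Ccv) C.
Proof.
apply: idem_supported => v; apply: val_inj.
by rewrite val_corner_ract !corner_idem.
Qed.

Lemma val_corner_kscale (c : k) v : val (kscale c v) = kscale c (val v).
Proof. by rewrite val_corner_ract -/(kscale c _) kscale_ract corner_idem. Qed.

(** The projections to X e_C of vectors spanning X over k span X e_C over k; mere
    generators of X need not project to generators. *)
Lemma corner_fg : finitely_generated X -> finitely_generated (corner Ccv).
Proof.
move=> /fg_kspan[n [g gS]]; apply/fg_kspan.
exists n, (fun i => to_corner (g i)) => v; have [c vE] := gS (val v).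
exists c; apply: val_inj.
rewrite -corner_idem [in LHS]vE ract_suml raddf_sum; apply: eq_bigr => i _.
by rewrite kscale_ract; symmetry; apply: val_corner_kscale.
Qed.

End Corner.

Lemma corner_short_exact (X : lmodType A^c) C (Cup : upper_set C) :
  exists (i : {linear corner X (upper_set_convex Cup) -> X})
         (p : {linear X -> corner X (upper_setC_convex Cup)}), short_exact i p.
Proof.
have [|i iE] := @linear_exists _ (corner X (upper_set_convex Cup)) X val.
  apply: ract_linear => [v w|v a]; first exact: raddfD.
  rewrite val_corner_ract -[RHS](ract_set_idemC C).
  rewrite -[X in _ = _ + X ** _ ** _]corner_idem -!ractM mulrA.
  by rewrite upper_set_idem // ract0r addr0 ractM.
have [|p pE] := @linear_exists _ X (corner X (upper_setC_convex Cup))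
    (@to_corner X (~: C) _).
  apply: ract_linear => [v w|v a]; apply: val_inj.
    by rewrite raddfD /= ractDl.
  rewrite val_corner_ract /= -[in LHS](ract_set_idemC C v) 2!ractDl.
  by rewrite -!ractM mulrA upper_set_idem // ract0r add0r mulrA.
exists i, p; split=> [v w|v|v].
- by rewrite !iE; apply: val_inj.
- by exists (val v); rewrite pE; apply: val_inj; rewrite /= corner_idem.
split=> [|[w <-]].
  rewrite pE => /(congr1 val)/= v0; exists (to_corner _ v).
  by rewrite iE /= -[RHS](ract_set_idemC C) v0 addr0.
rewrite pE iE; apply: val_inj => /=; rewrite -corner_idem.
rewrite -[set_idem C]mulr1 -!ractM upper_set_idem ?ract0r //.
Qed.

(** * Omega-torsion pairs from upper sets *)

Lemma supported_iso (X Y : lmodType A^c) C :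
  isomorphic X Y -> supported X C -> supported Y C.
Proof.
case=> f [g fK gK] XC x xC v.
by rewrite -(gK v) -linear_ract XC // linear0.
Qed.

Lemma supported_hom (X Y : lmodType A^c) C :
  supported X C -> supported Y (~: C) -> Hom_is_zero X Y.
Proof.
move=> XC YC f v; rewrite -(supported_idem (f v) YC) -linear_ract.
by rewrite -[v](supported_idem _ XC) -ractM set_idemMC ract0r linear0.
Qed.

Lemma supported_zero (X : lmodType A^c) C :
  supported X C -> supported X (~: C) -> forall v : X, v = 0.
Proof. by move=> XC XC' v; apply: (supported_hom XC XC' idfun). Qed.

(** The splitting sends m to (m (1 - e_C), p m), where p kills the first
    component, which is therefore a vector of Y. *)
Lemma supported_Ext1 (X Y : lmodType A^c) C :
  upper_set C -> supported X C -> supported Y (~: C) -> Ext1_is_zero X Y.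
Proof.
move=> Cup XC YC; apply/Ext1_is_zeroP => -[M i p [iI pS ipE]].
have in_i (m : M) : exists n, i n = m ** set_idem (~: C).
  apply/ipE; rewrite linear_ract -(supported_idem (p m) XC) -ractM.
  by rewrite set_idemMC ract0r.
have [r rE] := choice in_i.
have ri n : r (i n) = n.
  by apply: iI; rewrite rE -linear_ract (supported_idem n YC).
have r_lin (m : M) a : r (m ** a) = r m ** a.
  apply: iI; rewrite rE linear_ract rE.
  rewrite -{1}[m](ract_set_idemC C) 2!ractDl -2!ractM mulrA.
  rewrite upper_set_idem // ract0r add0r.
  by rewrite -(rE m) -!linear_ract (supported_idem _ YC).
have [|h hE] := @linear_exists _ M (Y * X)%type (fun m => (r m, p m)).
  apply: ract_linear => [v w|v a].
    rewrite linearD; congr (_, _); apply: iI.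
    by rewrite linearD !rE ractDl.
  by rewrite linear_ract r_lin.
have pi0 n : p (i n) = 0 by apply/ipE; exists n.
exists h; split=> [|n|m]; last 2 first.
- by apply: etrans (hE _) _; rewrite ri pi0.
- by change ((h m).2 = p m); rewrite hE.
apply: bijective_of_inj_surj => [|[n x]].
  apply: raddf_inj => m hm0.
  have [rm0 /ipE[n nE]] : (r m, p m) = (0, 0) by rewrite -hE.
  by rewrite -nE ri in rm0; rewrite -nE rm0 linear0.
have [m0 m0E] := pS x; exists (m0 ** set_idem C + i n).
apply: etrans (hE _) _.
congr (_, _); last first.
  by rewrite linearD (pi0 n) addr0 linear_ract m0E supported_idem.
apply: iI; rewrite rE ractDl -ractM set_idemMC ract0r add0r.
by rewrite -linear_ract supported_idem.
Qed.

Lemma supported_torsion_pair C : upper_set C ->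
  @is_torsion_pair A (fun X => supported X C) (fun X => supported X (~: C)).
Proof.
move=> Cup; split=> [X Y|X Y|X Y|X]; try exact: supported_iso.
  exact: supported_hom.
have [i [p ip]] := corner_short_exact X Cup.
exists (FgModule (corner_fg (upper_set_convex Cup) (fg_carrierP X))).
exists (FgModule (corner_fg (upper_setC_convex Cup) (fg_carrierP X))).
split; [exact: corner_supported | exact: corner_supported |].
by exists i, p.
Qed.

Definition upper_set_pair C (Cup : upper_set C) : omega_torsion_pair A :=
  OmegaTorsionPair (supported_torsion_pair Cup)
    (fun X Y => @supported_Ext1 X Y C Cup).

(** * The upper set of an omega-torsion pair *)

(** The image of the torsion part in the simple module is everything or zero. *)
Lemma simple_torsion_or_free (T F : fg_module A -> Prop) x :
  is_torsion_pair T F -> T (simple_fgmod x) \/ F (simple_fgmod x).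
Proof.
move=> [Tiso Fiso _ /(_ (simple_fgmod x))[tS [fS [TtS FfS [i [p ip]]]]]].
have [iI pS ipE] := ip.
have [[t it0]|i0] := EM (exists t, i t <> 0).
  left; apply: Tiso TtS; apply: short_exact_inj_iso ip _ => z.
  have [s <-] := pS z; apply/ipE.
  have [a <-] := @simple_cyclic x (i t) s (introN eqP it0).
  by exists (t ** a); rewrite linear_ract.
right; apply: Fiso FfS; apply: isomorphic_sym.
apply: short_exact_proj_iso ip _ => t; apply: iI; rewrite linear0.
by apply: contrapT => it0; apply: i0; exists t.
Qed.

Section TorsionSet.
Context (p : omega_torsion_pair A).

Definition torsion_set : {set P} :=
  [set x | `[< tp_torsion p (simple_fgmod x) >]].

Lemma torsion_setP x :
  reflect (tp_torsion p (simple_fgmod x)) (x \in torsion_set).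
Proof. by rewrite inE; apply: asboolP. Qed.

Lemma torsion_setPn x : x \notin torsion_set -> tp_free p (simple_fgmod x).
Proof.
move=> /torsion_setP nT.
by case: (simple_torsion_or_free x (tp_is_torsion_pair p)).
Qed.

(** Induction on the number of points strictly between x and y: an intermediate
    point splits the interval into two shorter ones, and in its absence
    [cover_Ext1] applies. *)
Lemma torsion_set_upper : upper_set torsion_set.
Proof.
suff lt_up n x y : (#|[set z | (x < z < y)%O]| < n)%N -> (x < y)%O ->
    x \in torsion_set -> y \in torsion_set.
  move=> x y xI; rewrite le_eqVlt => /predU1P[<- //|xy].
  exact: lt_up (leqnn _) xy xI.
elim: n x y => // n IHn x y; rewrite ltnS => le_n xy xI.
have sub_n x' y' z : (x < z < y)%O -> (x <= x')%O -> (y' <= y)%O ->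
    ~~ (x' < z < y')%O -> (#|[set z | (x' < z < y')%O]| < n)%N.
  move=> xzy xx' yy' nz; apply: leq_trans le_n; apply: proper_card.
  apply/properP; split; last by exists z; rewrite inE // (negPf nz).
  apply/subsetP => t; rewrite !inE => /andP[x't ty'].
  by rewrite (le_lt_trans xx' x't) (lt_le_trans ty' yy').
have [[z /andP[xz zy]]|cov] := EM (exists z, (x < z < y)%O).
  have zI : z \in torsion_set.
    apply: (IHn _ _ _ xz xI); apply: (sub_n _ _ z) => //;
      last by rewrite ltxx andbF.
      by rewrite xz.
    exact: ltW.
  apply: (IHn _ _ _ zy zI); apply: (sub_n _ _ z) => //; last by rewrite ltxx.
    by rewrite xz.
  exact: ltW.
apply: contraT => /torsion_setPn Fy; exfalso.
have nxy : no_point_between x y.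
  by move=> z xz zy; apply: cov; exists z; rewrite xz.
apply: (cover_Ext1 xy nxy).
exact: (@tp_Ext1 _ p (simple_fgmod x) (simple_fgmod y)) (torsion_setP _ xI) Fy.
Qed.

(** The points below a point outside the upper set are again outside, so a
    minimal bad point is minimal in the whole support of X, and X maps onto the
    torsion-free simple module there. *)
Lemma torsion_supported (X : fg_module A) :
  tp_torsion p X -> supported X torsion_set.
Proof.
move=> TX x xI; apply: contrapT => nv.
have [y [[yI nvy] ymin]] := @exists_maximal _ P^d
  (fun y => y \notin torsion_set /\ ~ vanishes_at X y) x (conj xI nv).
have [_ _ TF0 _] := tp_is_torsion_pair p.
apply/nvy/vanishes_of_hom_to_simple; first exact: fg_carrierP.
  move=> z zy; apply: contrapT => nvz; apply: (ymin z) => //; split=> //.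
  by apply: contra yI => /torsion_set_upper; apply; apply: ltW.
exact: TF0 (simple_fgmod y) TX (torsion_setPn yI).
Qed.

(** Dual to [torsion_supported]: a maximal bad point is maximal in the support
    of Y, so the torsion simple module there embeds into Y. *)
Lemma free_supported (Y : fg_module A) :
  tp_free p Y -> supported Y (~: torsion_set).
Proof.
move=> FY x; rewrite inE negbK => xI; apply: contrapT => nv.
have [y [[yI nvy] ymax]] := @exists_maximal _ P
  (fun y => y \in torsion_set /\ ~ vanishes_at Y y) x (conj xI nv).
have [_ _ TF0 _] := tp_is_torsion_pair p.
apply/nvy/vanishes_of_hom_from_simple.
  move=> z yz; apply: contrapT => nvz; apply: (ymax z) => //; split=> //.
  exact: torsion_set_upper yI (ltW yz).
exact: TF0 (simple_fgmod y) _ (torsion_setP _ yI) FY.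
Qed.

Lemma tp_torsionE (X : fg_module A) :
  tp_torsion p X <-> supported X torsion_set.
Proof.
split=> [|XI]; first exact: torsion_supported.
have [Tiso _ _ /(_ X)[tX [fX [TtX FfX [i [q iq]]]]]] := tp_is_torsion_pair p.
have [_ qS _] := iq; apply: Tiso TtX; apply: short_exact_inj_iso iq _.
apply: supported_zero (free_supported FfX) => x xI v; have [w <-] := qS v.
by rewrite -linear_ract XI // linear0.
Qed.

Lemma tp_freeE (Y : fg_module A) :
  tp_free p Y <-> supported Y (~: torsion_set).
Proof.
split=> [|YI]; first exact: free_supported.
have [_ Fiso _ /(_ Y)[tY [fY [TtY FfY [i [q iq]]]]]] := tp_is_torsion_pair p.
have [iI _ _] := iq; apply: Fiso FfY; apply: isomorphic_sym.
apply: short_exact_proj_iso iq _.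
apply: supported_zero (torsion_supported TtY) _ => x xI v; apply: iI.
by rewrite linear_ract YI // linear0.
Qed.

End TorsionSet.

Lemma torsion_set_pair C (Cup : upper_set C) :
  torsion_set (upper_set_pair Cup) = C.
Proof.
by apply/setP => x; apply/torsion_setP/idP => /supported_simple.
Qed.

Lemma torsion_set_inj : injective torsion_set.
Proof.
move=> p q pq.
have TE : tp_torsion p = tp_torsion q.
  by apply/funext => X; apply/propext; rewrite !tp_torsionE pq.
have FE : tp_free p = tp_free q.
  by apply/funext => X; apply/propext; rewrite !tp_freeE pq.
case: p q TE FE {pq} => [T F Tp Te] [T' F' Tp' Te'] /= TT FF.
subst T' F'; congr OmegaTorsionPair; exact: Prop_irrelevance.
Qed.

Lemma omega_leE p q : omega_le p q <-> torsion_set p \subset torsion_set q.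
Proof.
split=> [pq|/subsetP pq X].
  by apply/subsetP => x /torsion_setP/pq/torsion_setP.
rewrite !tp_torsionE => Xp x xq; apply: Xp; exact: contra (@pq x) xq.
Qed.

Lemma upper_set_ideal C :
  upper_set C <-> (C : {set P^d}) \in @is_order_ideal _ P^d.
Proof.
split=> [Cup|/is_order_idealP Cid x y xC xy]; last exact: Cid xC xy.
by apply/is_order_idealP => x y; apply: Cup.
Qed.

End IncidenceModules.

Theorem proposition1p1 (d : Order.disp_t) (P : finPOrderType d) (k : fieldType) :
  exists f : omega_torsion_pair (incidence_algebra k P) -> order_ideal P^d,
    bijective f /\
    (forall p q : omega_torsion_pair (incidence_algebra k P),
       omega_le p q <-> (f p <= f q)%O).
Proof.
pose f (p : omega_torsion_pair (incidence_algebra k P)) : order_ideal P^d :=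
  OrderIdeal ((upper_set_ideal _).1 (@torsion_set_upper _ _ _ p)).
exists f; split=> [|p q]; last by rewrite le_order_ideal; apply: omega_leE.
apply: bijective_of_inj_surj => [p q pq|I].
  by apply: torsion_set_inj; have /(congr1 (@ideal_set _ _)) := pq.
have Iup : upper_set (I : {set P}) := (upper_set_ideal _).2 (ideal_setP I).
by exists (upper_set_pair k Iup); apply: val_inj; rewrite /= torsion_set_pair.
Qed.
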